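(* Suppose the plant graph $G_{\mathcal P}$ contains no isolated node and no sink, the design graph $G_{\mathcal C}$ is the totally disconnected graph with self-loops (i.e. $S_{\mathcal C}=I_q$), and $G_{\mathcal K}\supseteq G_{\mathcal P}$. Then every control design method $\Gamma\in\mathcal C$ satisfies $$r_{\mathcal P}(\Gamma)\ge 1+\frac{1}{\epsilon^2}.$$
   Context: Fix integers $q\ge 1$ and $n_1,\dots,n_q\ge 1$, put $n=\sum_{i=1}^q n_i$, and fix a real $\epsilon>0$. Matrices $M\in\mathbb R^{n\times n}$ are partitioned into blocks $M_{ij}\in\mathbb R^{n_i\times n_j}$, $1\le i,j\le q$. Graphs are directed with vertex set $\{1,\dots,q\}$, possibly with self-loops. The adjacency matrix $S=(s_{ij})$ of $G=(\{1,\dots,q\},E)$ is $s_{ij}=1$ if $(j,i)\in E$ and $s_{ij}=0$ otherwise. $G'\supseteq G$ means the edge set of $G'$ contains that of $G$. A vertex $i$ is a sink if there is no $j\ne i$ with $(i,j)\in E$; it is isolated if there is no $j\ne i$ with $(i,j)\in E$ or $(j,i)\in E$. Plants: given the plant graph $G_{\mathcal P}$ with adjacency matrix $S_{\mathcal P}$, let $\mathcal A(S_{\mathcal P})=\{A\in\mathbb R^{n\times n}: A_{ij}=0 \text{ whenever } (s_{\mathcal P})_{ij}=0\}$, and let $\mathcal B(\epsilon)$ be the set of diagonal $n\times n$ matrices with all diagonal entries $\ge\epsilon$. The set of plants is $\mathcal P=\mathcal A(S_{\mathcal P})\times\mathcal B(\epsilon)\times\mathbb R^n$; $P=(A,B,x_0)$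 stands for the system $x(k+1)=Ax(k)+Bu(k)$, $x(0)=x_0$. Controllers: given the control graph $G_{\mathcal K}$ with adjacency matrix $S_{\mathcal K}$, let $\mathcal K=\{K\in\mathbb R^{n\times n}: K_{ij}=0 \text{ whenever } (s_{\mathcal K})_{ij}=0\}$; $K$ acts by $u(k)=Kx(k)$. Cost: $J_P(K)=\sum_{k=1}^\infty x(k)^Tx(k)+\sum_{k=0}^\infty u(k)^Tu(k)\in[0,\infty]$, evaluated along the closed loop of $P$ with $u=Kx$. Design methods: a control design method is a map $\Gamma:\mathcal A(S_{\mathcal P})\times\mathcal B(\epsilon)\to\mathcal K$. Given a design graph $G_{\mathcal C}$ with adjacency matrix $S_{\mathcal C}$, $\mathcal C$ is the set of control design methods $\Gamma$ with structure $G_{\mathcal C}$, meaning that for each $i$ the block row $[\Gamma_{i1}\ \cdots\ \Gamma_{iq}]$ is a function only of $\{[A_{j1}\ \cdots\ A_{jq}],\,B_{jj}: (s_{\mathcal C})_{ij}\ne 0\}$. Competitive ratio: it is assumed that for every $P\in\mathcal P$ there is an optimal controller $K^*(P)\in\mathcal K$, i.e. $J_P(K^*(P))\le J_P(K)$ for all $K\in\mathcal K$. Set $$r_{\mathcal P}(\Gamma)=\sup_{P=(A,B,x_0)\in\mathcal P}\frac{J_P(\Gamma(A,B))}{J_P(K^*(P))},$$ with the conventions $0/0=1$ and $c/0=\infty$ for $c>0$. *)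

(* Defs.v *)
From HB Require Import structures.
From mathcomp Require Import all_boot all_order all_algebra.
From mathcomp Require Import all_classical all_reals.
From mathcomp Require Import ereal topology normedtype sequences.

Set Implicit Arguments.
Unset Strict Implicit.
Unset Printing Implicit Defensive.

Import Order.TTheory GRing.Theory Num.Theory.
Import numFieldNormedType.Exports.

Local Open Scope classical_set_scope.
Local Open Scope ring_scope.

(* A digraph on q vertices is its edge relation: [G i j] means (i, j) is an
   edge. *)
Section Digraphs.
Variables (q : nat).
Implicit Type G : rel 'I_q.

(* Entry (i, j) is 1 when (j, i), not (i, j), is an edge. *)
Definition adjmx G : 'M[nat]_q := \matrix_(i, j) nat_of_bool (G j i).

Definition is_sink G (i : 'I_q) : Prop :=
  ~ exists j, j != i /\ G i j.

Definition is_isolated G (i : 'I_q) : Prop :=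
  ~ exists j, j != i /\ (G i j || G j i).

End Digraphs.

Section Control.
Variables (R : realType) (q : nat) (n_ : 'I_q -> nat).

Local Notation n := (\sum_(i < q) n_ i)%N.

Definition structured (S : 'M[nat]_q) : set 'M[R]_n :=
  [set M | forall i j, S i j = 0%N -> submxblock M i j = 0].

Definition actuation (eps : R) : set 'M[R]_n :=
  [set B | is_diag_mx B /\ forall i, eps <= B i i].

(* A plant ((A, B), x0) is the system x(k+1) = A x(k) + B u(k), x(0) = x0. *)
Definition plant : Type := (('M[R]_n * 'M[R]_n) * 'cV[R]_n)%type.

Definition plants (G_P : rel 'I_q) (eps : R) : set plant :=
  structured (adjmx G_P) `*` actuation eps `*` setT.

Definition controllers (G_K : rel 'I_q) : set 'M[R]_n :=
  structured (adjmx G_K).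

Definition state (P : plant) (K : 'M[R]_n) (k : nat) : 'cV[R]_n :=
  let: ((A, B), x0) := P in
  iter k (fun x => A *m x + B *m (K *m x)) x0.

Definition input (P : plant) (K : 'M[R]_n) (k : nat) : 'cV[R]_n :=
  K *m state P K k.

Definition sqnorm (v : 'cV[R]_n) : R := (v^T *m v) 0 0.

Definition cost (P : plant) (K : 'M[R]_n) : \bar R :=
  (\sum_(1 <= k <oo) (sqnorm (state P K k))%:E
   + \sum_(0 <= k <oo) (sqnorm (input P K k))%:E)%E.

Definition optimal_controller (G_K : rel 'I_q) (P : plant) (K : 'M[R]_n) :=
  controllers G_K K /\
  forall K', controllers G_K K' -> (cost P K <= cost P K')%E.

(* A design method is represented by a total function, of which only the
   restriction to the set of admissible pairs (A, B) is ever constrained or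
   used.  [submxcol A j] is the block row [A_j1 ... A_jq] (a block of the
   column of block rows). *)
Definition design_method (G_P G_K G_C : rel 'I_q) (eps : R)
    (Gamma : 'M[R]_n -> 'M[R]_n -> 'M[R]_n) : Prop :=
  (forall A B, structured (adjmx G_P) A -> actuation eps B ->
     controllers G_K (Gamma A B)) /\
  (forall i A B A' B',
     structured (adjmx G_P) A -> actuation eps B ->
     structured (adjmx G_P) A' -> actuation eps B' ->
     (forall j, adjmx G_C i j <> 0%N ->
        submxcol A j = submxcol A' j /\ submxblock B j j = submxblock B' j j) ->
     submxcol (Gamma A B) i = submxcol (Gamma A' B') i).

(* In the library c / 0 = +oo for c > 0, but 0 / 0 = 0, whence the case
   split.  The value at d = +oo is immaterial: the optimal cost is finite as
   soon as G_K contains G_P, since then K = - B^-1 A is a controller. *)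
Definition cost_ratio (c d : \bar R) : \bar R :=
  if (c == 0%E) && (d == 0%E) then 1%E else (c / d)%E.

(* [Kstar] selects an optimal controller for each plant; the value does not
   depend on the selection, since any two of them have the same cost. *)
Definition competitive_ratio (G_P : rel 'I_q) (eps : R)
    (Kstar : plant -> 'M[R]_n) (Gamma : 'M[R]_n -> 'M[R]_n -> 'M[R]_n)
    : \bar R :=
  ereal_sup [set cost_ratio (cost P (Gamma P.1.1 P.1.2)) (cost P (Kstar P))
            | P in plants G_P eps].

End Control.

(* Main.v *)
(** Let [i -> j -> l] be edges with [i != j] and [j != l], pick state indices
    [b], [a], [d] in the blocks [i], [j], [l], and start the plant
    [A = delta_mx a b], [B = eps%:M] from the basis vector [e_b].

    If [Gamma] cancels the entry [(a, b)] of the closed loop, its first input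
    already costs [1 / eps^2], whereas the feedback
    [- eps / (1 + eps^2) *: delta_mx a b] costs only [1 / (1 + eps^2)].

    Otherwise [x(1)] has a component [c != 0] along [e_a].  As [Gamma] computes
    its [j]-th block row without knowledge of the [l]-th block row of [A],
    adding [r *: delta_mx d a] to [A] does not change [c], and the next step
    costs at least [(r c)^2 / (1 + eps^2)], while deadbeat control still costs
    [1 / eps^2]; so a large [r] violates any given ratio. *)

Require Import Defs.
From mathcomp Require Import all_boot all_order all_algebra.
From mathcomp Require Import all_classical all_reals.
From mathcomp Require Import ereal topology normedtype sequences.
From mathcomp Require Import ring.

Import Order.TTheory GRing.Theory Num.Theory.

Local Open Scope ring_scope.

Lemma sqnorm_sum (R : realType) (q : nat) (n_ : 'I_q -> nat)
    (v : 'cV[R]_(\sum_(i < q) n_ i)) :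
  sqnorm v = \sum_i v i 0 ^+ 2.
Proof. by rewrite /sqnorm mxE; apply: eq_bigr => i _; rewrite mxE expr2. Qed.

Lemma sqnorm_ge0 (R : realType) (q : nat) (n_ : 'I_q -> nat)
    (v : 'cV[R]_(\sum_(i < q) n_ i)) :
  0 <= sqnorm v.
Proof. by rewrite sqnorm_sum sumr_ge0// => i _; exact: sqr_ge0. Qed.

Lemma sqnorm0 (R : realType) (q : nat) (n_ : 'I_q -> nat) :
  sqnorm (0 : 'cV[R]_(\sum_(i < q) n_ i)) = 0.
Proof. by rewrite /sqnorm mulmx0 mxE. Qed.

Lemma sqr_le_sqnorm (R : realType) (q : nat) (n_ : 'I_q -> nat)
    (v : 'cV[R]_(\sum_(i < q) n_ i)) i :
  v i 0 ^+ 2 <= sqnorm v.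
Proof.
by rewrite sqnorm_sum (bigD1 i)//= lerDl sumr_ge0// => k _; exact: sqr_ge0.
Qed.

Lemma sqnorm_scale_delta (R : realType) (q : nat) (n_ : 'I_q -> nat) (c : R)
    (i : 'I_(\sum_(i < q) n_ i)) :
  sqnorm (c *: delta_mx i 0) = c ^+ 2.
Proof.
rewrite sqnorm_sum (bigD1 i)//= !mxE !eqxx mulr1 big1 ?addr0// => k ki.
by rewrite !mxE (negbTE ki) mulr0 expr0n.
Qed.

Lemma delta_mulmx_cV (R : pzSemiRingType) m (i j k : 'I_m) (v : 'cV[R]_m) :
  (delta_mx i j *m v) k 0 = (k == i)%:R * v j 0.
Proof.
rewrite mxE (bigD1 j)//= mxE eqxx andbT big1 ?addr0// => h hj.
by rewrite mxE (negbTE hj) andbF mul0r.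
Qed.

Lemma structured_scale_delta (R : realType) (q : nat) (n_ : 'I_q -> nat)
    (S : 'M[nat]_q) (c : R) i j (a : 'I_(n_ i)) (b : 'I_(n_ j)) :
  S i j <> 0%N ->
  structured S
    (c *: delta_mx (tagnat.Rank i a) (tagnat.Rank j b) : 'M_(\sum_i n_ i)).
Proof.
move=> Sij k h Skh; apply/matrixP => x y; rewrite !mxE.
have [/eqP ka|] := eqVneq (tagnat.Rank k x) _; last by rewrite mulr0.
have [/eqP hb|] := eqVneq (tagnat.Rank h y) _; last by rewrite andbF mulr0.
move: ka hb => /eqP/(congr1 tagnat.sig1) + /eqP/(congr1 tagnat.sig1).
by rewrite !tagnat.Rank1K => kE hE; rewrite kE hE in Skh.
Qed.

Lemma structuredD (R : realType) (q : nat) (n_ : 'I_q -> nat) (S : 'M[nat]_q)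
    (M N : 'M[R]_(\sum_(i < q) n_ i)) :
  structured S M -> structured S N -> structured S (M + N).
Proof.
by move=> SM SN i j Sij; rewrite submxblockD SM// SN// addr0.
Qed.

Lemma structuredZ (R : realType) (q : nat) (n_ : 'I_q -> nat) (S : 'M[nat]_q)
    (c : R) (M : 'M[R]_(\sum_(i < q) n_ i)) :
  structured S M -> structured S (c *: M).
Proof.
move=> SM i j Sij; apply/matrixP => x y.
by have /matrixP/(_ x y) := SM _ _ Sij; rewrite !mxE => ->; rewrite mulr0.
Qed.

Lemma structured_subrel (R : realType) (q : nat) (n_ : 'I_q -> nat)
    (G G' : rel 'I_q) (M : 'M[R]_(\sum_(i < q) n_ i)) :
  subrel G G' -> structured (adjmx G) M -> structured (adjmx G') M.
Proof.
move=> GG' SM i j; rewrite mxE => G'ji; apply: SM; rewrite mxE.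
by case Gji : (G j i); move: G'ji => //; rewrite (GG' _ _ Gji).
Qed.

Lemma actuation_scalar (R : realType) (q : nat) (n_ : 'I_q -> nat) (eps : R) :
  actuation eps (eps%:M : 'M[R]_(\sum_(i < q) n_ i)).
Proof.
split; first exact: scalar_mx_is_diag.
by move=> i; rewrite mxE eqxx mulr1n.
Qed.

Lemma stateS (R : realType) (q : nat) (n_ : 'I_q -> nat)
    (A B K : 'M[R]_(\sum_(i < q) n_ i)) x0 k :
  state ((A, B), x0) K k.+1 = (A + B *m K) *m state ((A, B), x0) K k.
Proof. by rewrite mulmxDl -mulmxA. Qed.

Lemma cost_ge0 (R : realType) (q : nat) (n_ : 'I_q -> nat) (P : plant R n_)
    (K : 'M[R]_(\sum_(i < q) n_ i)) :
  (0 <= cost P K)%E.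
Proof.
by rewrite adde_ge0// nneseries_ge0// => k _ _; rewrite lee_fin sqnorm_ge0.
Qed.

(** The state series starts at 1 and the input series at 0, so [x(k+1)] pairs with the [u(k)] that
    acts on it; [one_step_lower_bound] needs this pairing. *)
Lemma cost_ge_step (R : realType) (q : nat) (n_ : 'I_q -> nat) (P : plant R n_)
    (K : 'M[R]_(\sum_(i < q) n_ i)) k :
  ((sqnorm (state P K k.+1) + sqnorm (input P K k))%:E <= cost P K)%E.
Proof.
have le_series m (u : nat -> R) h : (forall n, 0 <= u n) -> (m <= h)%N ->
    ((u h)%:E <= \sum_(m <= n <oo) (u n)%:E)%E.
  move=> u0 mh.
  have u0' n : (m <= n)%N -> true -> (0 <= (u n)%:E)%E by rewrite lee_fin.
  apply: le_trans (nneseries_lim_ge h.+1 u0').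
  by rewrite big_nat_recr//= leeDr// sume_ge0// => n _; rewrite lee_fin.
rewrite EFinD /cost; apply: leeD.
  by apply: (le_series 1%N (fun n => sqnorm (state P K n))) => // n;
    exact: sqnorm_ge0.
by apply: (le_series 0%N (fun n => sqnorm (input P K n))) => // n;
  exact: sqnorm_ge0.
Qed.

(** The hypotheses say [A x(1) = 0] and [u(1) = 0], so the trajectory is zero from [x(2)] on. Both
    comparison controllers are of this kind. *)
Lemma cost_one_step (R : realType) (q : nat) (n_ : 'I_q -> nat)
    (A B K : 'M[R]_(\sum_(i < q) n_ i)) x0 :
  A *m ((A + B *m K) *m x0) = 0 -> K *m ((A + B *m K) *m x0) = 0 ->
  cost ((A, B), x0) K =
  (sqnorm ((A + B *m K) *m x0) + sqnorm (K *m x0))%:E.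
Proof.
move=> Ax1 Kx1.
have x2 k : state ((A, B), x0) K k.+2 = 0.
  elim: k => [|k IHk]; last by rewrite stateS IHk mulmx0.
  by rewrite !stateS /= mulmxDl -mulmxA Ax1 Kx1 mulmx0 addr0.
have u1 k : input ((A, B), x0) K k.+1 = 0.
  case: k => [|k]; first by rewrite /input stateS /= Kx1.
  by rewrite /input x2 mulmx0.
rewrite /cost EFinD (nneseries_split 1 1); last first.
  by move=> k _; rewrite lee_fin sqnorm_ge0.
rewrite (nneseries_split 0 1); last first.
  by move=> k _; rewrite lee_fin sqnorm_ge0.
rewrite !big_nat1 !eseries0 ?adde0 ?stateS//.
  by case=> // k _ _; rewrite u1 sqnorm0.
by case=> [|[|k]]// _ _; rewrite x2 sqnorm0.
Qed.

Lemma cost_deadbeat (R : realType) (q : nat) (n_ : 'I_q -> nat) (eps : R)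
    (A : 'M[R]_(\sum_(i < q) n_ i)) x0 : eps != 0 ->
  cost ((A, eps%:M), x0) (- eps^-1 *: A) = (sqnorm (- eps^-1 *: (A *m x0)))%:E.
Proof.
move=> eps0.
have closed_loop0 : A + eps%:M *m (- eps^-1 *: A) = 0.
  by rewrite mul_scalar_mx scalerA mulrN divff// scaleN1r subrr.
rewrite cost_one_step closed_loop0 mul0mx ?mulmx0//.
by rewrite sqnorm0 add0r scalemxAl.
Qed.

(* Minimising [(y + e u)^2 + u^2] over [u] gives [y^2 / (1 + e^2)]. *)
Lemma one_step_lower_bound (R : realFieldType) (e y u : R) :
  y ^+ 2 / (1 + e ^+ 2) <= (y + e * u) ^+ 2 + u ^+ 2.
Proof.
have e1 : 0 < 1 + e ^+ 2 by rewrite ltr_pwDl// sqr_ge0.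
rewrite ler_pdivrMr// -subr_ge0.
rewrite [leRHS](_ : _ = (e * y + (1 + e ^+ 2) * u) ^+ 2) ?sqr_ge0//.
by ring.
Qed.

(** Positivity of [r * D] forces [c > 0]. This rules out the case 0 / 0, and [d = 0] then makes the
    ratio infinite. *)
Lemma le_cost_ratio (R : realType) (r D : R) (c d : \bar R) :
  0 < r -> 0 < D -> (0 <= d)%E -> (d <= D%:E)%E -> ((r * D)%:E <= c)%E ->
  (r%:E <= cost_ratio c d)%E.
Proof.
move=> r0 D0; rewrite /cost_ratio.
case: d => [d| |] //.
rewrite !lee_fin => d0 dD cge.
have c0 : (0 < c)%E by apply: lt_le_trans cge; rewrite lte_fin mulr_gt0.
rewrite (gt_eqF c0) /=.
have [->|dN0] := eqVneq d 0; first by rewrite inve0 gt0_muley// leey.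
have dgt0 : 0 < d by rewrite lt_neqAle eq_sym dN0.
rewrite inver (negbTE dN0) lee_pdivlMr//; apply: le_trans cge.
by rewrite -EFinM lee_fin ler_pM2l.
Qed.

(** The optimal cost need not be computed: any admissible [K] bounds it from above. *)
Lemma le_competitive_ratio (R : realType) (q : nat) (n_ : 'I_q -> nat) (eps : R)
    (G_P G_K : rel 'I_q) (Kstar : plant R n_ -> 'M[R]_(\sum_(i < q) n_ i))
    (Gamma : 'M[R]_(\sum_(i < q) n_ i) -> 'M[R]_(\sum_(i < q) n_ i) ->
             'M[R]_(\sum_(i < q) n_ i))
    (P : plant R n_) (K : 'M[R]_(\sum_(i < q) n_ i)) (r D : R) :
  plants G_P eps P -> optimal_controller G_K P (Kstar P) ->
  controllers G_K K -> (cost P K <= D%:E)%E ->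
  0 < r -> 0 < D -> ((r * D)%:E <= cost P (Gamma P.1.1 P.1.2))%E ->
  (r%:E <= competitive_ratio G_P eps Kstar Gamma)%E.
Proof.
move=> PP [_ Kopt] KK KD r0 D0 cge.
apply: le_trans (ereal_sup_ubound _); last by exists P.
exact: (@le_cost_ratio _ _ D _ _ r0 D0 (cost_ge0 _ _ _ _ _)
  (le_trans (Kopt _ KK) KD) cge).
Qed.

Theorem theorem3p10 (R : realType) (q : nat) (n_ : 'I_q -> nat) (eps : R)
    (G_P G_K G_C : rel 'I_q)
    (Kstar : plant R n_ -> 'M[R]_(\sum_(i < q) n_ i)%N)
    (q_ge1 : (1 <= q)%N) (n_ge1 : forall i, (1 <= n_ i)%N) (eps_gt0 : 0 < eps)
    (Kstar_opt : forall P, plants G_P eps P ->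
       optimal_controller G_K P (Kstar P))
    (no_isolated : forall i, ~ is_isolated G_P i)
    (no_sink : forall i, ~ is_sink G_P i)
    (G_C_loops : adjmx G_C = 1%:M)
    (G_K_sup : subrel G_P G_K)
    (Gamma : 'M[R]_(\sum_(i < q) n_ i)%N -> 'M[R]_(\sum_(i < q) n_ i)%N ->
             'M[R]_(\sum_(i < q) n_ i)%N)
    (Gamma_design : design_method G_P G_K G_C eps Gamma) :
  ((1 + 1 / eps ^+ 2)%:E <= competitive_ratio G_P eps Kstar Gamma)%E.
Proof.
have next v : exists w, w != v /\ G_P v w by exact: contrapT (no_sink v).
have [j [ji Gij]] := next (Ordinal q_ge1).
move: (Ordinal q_ge1) ji Gij => i ji Gij.
(* [l] may coincide with [i], and then [d = b]; the argument rests on [a != b] and [d != a]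
   alone. *)
have [l [lj Gjl]] := next j.
have Rank_neq (v w : 'I_q) (x : 'I_(n_ v)) (y : 'I_(n_ w)) :
    v != w -> tagnat.Rank v x != tagnat.Rank w y.
  by apply: contra_neq => /(congr1 tagnat.sig1); rewrite !tagnat.Rank1K.
pose a' := Ordinal (n_ge1 j); pose b' := Ordinal (n_ge1 i).
pose d' := Ordinal (n_ge1 l).
pose a := tagnat.Rank j a'; pose b := tagnat.Rank i b'.
pose d := tagnat.Rank l d'.
have ab : a != b by exact: Rank_neq.
have da : d != a by exact: Rank_neq.
(* The edge from [i] to [j] frees block [(j, i)], which contains [(a, b)]; likewise [(d, a)] lies in
   block [(l, j)]. The factor [1] gives both summands the shape of [structured_scale_delta]. *)
pose A (r : R) : 'M[R]_(\sum_(i < q) n_ i) :=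
  1 *: delta_mx a b + r *: delta_mx d a.
pose B : 'M[R]_(\sum_(i < q) n_ i) := eps%:M.
have AS r : structured (adjmx G_P) (A r).
  by apply: structuredD; apply: structured_scale_delta; rewrite mxE ?Gij ?Gjl.
have BS : actuation eps B by exact: actuation_scalar.
pose x0 : 'cV[R]_(\sum_(i < q) n_ i) := delta_mx b 0.
have PS r : plants G_P eps ((A r, B), x0).
  by split=> [|//]; split; [exact: AS|exact: BS].
have eps0 : eps != 0 by rewrite gt_eqF.
have eps2 : 0 < eps ^+ 2 by rewrite exprn_gt0.
have eps2_1 : 0 < 1 + eps ^+ 2 by rewrite ltr_pwDl// ltW.
have ratio_gt0 : 0 < 1 + 1 / eps ^+ 2 by rewrite ltr_pwDl// divr_ge0// ltW.
have Gamma_ab r : Gamma (A r) B a b = Gamma (A 0) B a b.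
  have /matrixP/(_ a' b) : submxcol (Gamma (A r) B) j = submxcol (Gamma (A 0) B) j;
    last by rewrite !mxE.
  apply: Gamma_design.2 => // k; rewrite G_C_loops mxE.
  have [<- _|//] := eqVneq j k; split=> //.
  apply/matrixP => x y; rewrite !mxE.
  have jl : j != l by rewrite eq_sym.
  by rewrite (negbTE (Rank_neq _ _ x d' jl)) /= !mulr0.
(* By [Gamma_ab], this is the [(a, b)] entry of the closed loop of [A r] for every [r]. *)
pose c := 1 + eps * Gamma (A 0) B a b.
have Ax0 r : A r *m x0 = delta_mx a 0.
  rewrite mulmxDl -!scalemxAl mul_delta_mx mul_delta_mx_0//.
  by rewrite scaler0 addr0 scale1r.
have [c0|c0] := eqVneq c 0.
  (* The minimiser of [(1 + eps * k) ^+ 2 + k ^+ 2], the cost of [K]. *)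
  pose k := - (eps / (1 + eps ^+ 2)).
  pose K : 'M[R]_(\sum_(i < q) n_ i) := k *: delta_mx a b.
  have KK : controllers G_K K.
    apply: structured_subrel G_K_sup _; apply: structured_scale_delta.
    by rewrite mxE Gij.
  have Kx0 : K *m x0 = k *: delta_mx a 0 by rewrite -scalemxAl mul_delta_mx.
  have x1E : (A 0 + B *m K) *m x0 = (1 + eps * k) *: delta_mx a 0.
    by rewrite mulmxDl -mulmxA Ax0 Kx0 mul_scalar_mx scalerA scalerDl scale1r.
  have KD : cost ((A 0, B), x0) K = ((1 + eps ^+ 2)^-1)%:E.
    rewrite cost_one_step ?x1E -?scalemxAr.
    - rewrite Kx0 !sqnorm_scale_delta /k; congr (_%:E).
      by field; rewrite gt_eqF.
    - rewrite mulmxDl -!scalemxAl mul_delta_mx_0 1?eq_sym//.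
      by rewrite scale0r addr0 !scaler0.
    - by rewrite -scalemxAl mul_delta_mx_0 1?eq_sym// !scaler0.
  apply: (@le_competitive_ratio _ _ _ _ _ _ _ _ _ K _
    ((1 + eps ^+ 2)^-1) (PS 0) (Kstar_opt _ (PS 0)) KK _ ratio_gt0).
  - by rewrite KD.
  - by rewrite invr_gt0.
  (* Only component [a] of [u(0)] is kept; [c = 0] makes it [- eps^-1]. *)
  apply: le_trans (cost_ge_step _ _ _ _ _ 0%N); rewrite lee_fin /=.
  rewrite ler_wpDl ?sqnorm_ge0//; apply: le_trans (sqr_le_sqnorm _ _ _ _ a).
  rewrite /input /= -colE mxE.
  have -> : Gamma (A 0) B a b = - eps^-1.
    apply: (mulfI eps0); rewrite mulrN divff//; apply/eqP.
    by rewrite -addr_eq0 addrC; apply/eqP.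
  rewrite le_eqVlt; apply/orP; left; apply/eqP.
  by field; rewrite eps0 gt_eqF.
(* Chosen so that [(r * c) ^+ 2 / (1 + eps ^+ 2)] equals the claimed ratio times the deadbeat cost
   [(eps ^+ 2)^-1]. *)
pose r := (1 + eps ^+ 2) / eps ^+ 2 / c.
have KK : controllers G_K (- eps^-1 *: A r).
  by apply: structured_subrel G_K_sup _; exact: structuredZ.
apply: (@le_competitive_ratio _ _ _ _ _ _ _ _ _ (- eps^-1 *: A r) _
  ((eps ^+ 2)^-1) (PS r) (Kstar_opt _ (PS r)) KK _ ratio_gt0).
- by rewrite cost_deadbeat// Ax0 sqnorm_scale_delta sqrrN exprVn.
- by rewrite invr_gt0.
apply: le_trans (cost_ge_step _ _ _ _ _ 1%N); rewrite lee_fin /=.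
set K := Gamma (A r) B; set P := ((A r, B), x0).
have x1a : state P K 1 a 0 = c.
  rewrite /= Ax0 mxE mul_scalar_mx [X in _ + X]mxE -colE !mxE !eqxx.
  by rewrite /K Gamma_ab.
have x2d : state P K 2 d 0 = r * c + eps * input P K 1 d 0.
  rewrite stateS mulmxDl mxE -mulmxA [B *m _]mul_scalar_mx [X in _ + X]mxE.
  congr (_ + _); rewrite mulmxDl -!scalemxAl mxE [X in X + _]mxE [X in _ + X]mxE.
  by rewrite !delta_mulmx_cV (negbTE da) eqxx mul0r mulr0 add0r mul1r x1a.
(* Only component [d] of [x(2)] and [u(1)] is kept; the bound holds whatever value [u(1)] has
   there. *)
apply: le_trans (lerD (sqr_le_sqnorm _ _ _ _ d) (sqr_le_sqnorm _ _ _ _ d)).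
rewrite x2d; apply: le_trans (one_step_lower_bound _ _ _ _).
rewrite /r divfK// le_eqVlt; apply/orP; left; apply/eqP.
by field; rewrite eps0 gt_eqF.
Qed.
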